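(* Let $A,B\in\mathcal{S}_n$, $X\in\mathcal{M}_n$ and $r\ge 0$. Then for every $\mu\in[0,1]$ and every unitarily invariant norm $|||\cdot|||$ on $\mathcal{M}_n$, \begin{align*} |||\,|A^{1/2}XB^{1/2}|^r\,|||^2 &\le \frac{1}{|1-2\mu|}\left|\int_\mu^{1-\mu} |||\,|A^{s}XB^{1-s}|^r\,|||\;|||\,|A^{1-s}XB^{s}|^r\,|||\,ds\right|\\ &\le \frac12\Big[\,|||\,|A^{1/2}XB^{1/2}|^r\,|||^2+|||\,|A^{\mu}XB^{1-\mu}|^r\,|||\;|||\,|A^{1-\mu}XB^{\mu}|^r\,|||\,\Big]\\ &\le |||\,|A^{\mu}XB^{1-\mu}|^r\,|||\;|||\,|A^{1-\mu}XB^{\mu}|^r\,|||, \end{align*} where for $\mu=\tfrac12$ the second expression (the one with the integral) is understood as its limit as $\mu\to\tfrac12$, namely $|||\,|A^{1/2}XB^{1/2}|^r\,|||^2$.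
   Context: $\mathcal{M}_n$ is the algebra of $n\times n$ complex matrices, and $\mathcal{S}_n\subset\mathcal{M}_n$ is the set of positive semidefinite matrices. For $T\in\mathcal{M}_n$, $|T|=(T^*T)^{1/2}$. Nonnegative real powers of positive semidefinite matrices are taken by functional calculus, with the zeroth power equal to the identity matrix. A norm $|||\cdot|||$ on $\mathcal{M}_n$ is unitarily invariant if $|||UTV|||=|||T|||$ for all $T\in\mathcal{M}_n$ and all unitary $U,V\in\mathcal{M}_n$. *)

(* Defs.v *)
From HB Require Import structures.
From mathcomp Require Import all_boot all_order all_algebra.
From mathcomp Require Import sesquilinear spectral complex.
From mathcomp Require Import all_classical all_reals all_analysis.

Set Implicit Arguments.
Unset Strict Implicit.
Unset Printing Implicit Defensive.

Import Order.TTheory GRing.Theory Num.Theory.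
Import numFieldNormedType.Exports.

Local Open Scope classical_set_scope.
Local Open Scope ring_scope.
Local Open Scope complex_scope.
Local Open Scope sesquilinear_scope.

(* The order on [R[i]] relates only numbers with equal imaginary parts, so
   [0 <= z] says that [z] is real and nonnegative. *)
Definition psdmx (R : realType) (n : nat) (A : 'M[R[i]]_n) : Prop :=
  A \is hermsymmx /\
  forall v : 'cV[R[i]]_n, 0 <= (v ^t* *m A *m v) 0 0.

(* For Hermitian [A], [spectralmx A] is unitary, [spectral_diag A] is real and
   [A = invmx (spectralmx A) *m diag_mx (spectral_diag A) *m spectralmx A]
   (see [orthomx_spectralP]). *)
Definition mxcalc (R : realType) (n : nat) (f : R -> R) (A : 'M[R[i]]_n) :
    'M[R[i]]_n :=
  invmx (spectralmx A)
  *m diag_mx (map_mx (fun z => (f (complex.Re z))%:C) (spectral_diag A))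
  *m spectralmx A.

(* As [0 `^ 0 = 1] and [0 `^ s = 0] for [s != 0], the zeroth power is the
   identity matrix, also when [A] is singular. *)
Definition mxpowR (R : realType) (n : nat) (A : 'M[R[i]]_n) (s : R) :
    'M[R[i]]_n :=
  mxcalc (fun x => x `^ s) A.

Definition mxabs (R : realType) (n : nat) (T : 'M[R[i]]_n) : 'M[R[i]]_n :=
  mxpowR (T ^t* *m T) 2^-1.

(* Nonnegativity of [N] follows from these three properties. *)
Definition is_mxnorm (R : realType) (n : nat) (N : 'M[R[i]]_n -> R) : Prop :=
  [/\ forall S T, N (S + T) <= N S + N T,
      forall (c : R[i]) T, N (c *: T) = complex.Re `|c| * N T
    & forall T, N T = 0 -> T = 0].

Definition unitarily_invariant (R : realType) (n : nat)
    (N : 'M[R[i]]_n -> R) : Prop :=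
  forall T U V : 'M[R[i]]_n, U \is unitarymx -> V \is unitarymx ->
    N (U *m T *m V) = N T.

Definition oriented_integral (R : realType) (a b : R) (f : R -> R) : R :=
  if a <= b then \int[lebesgue_measure]_(s in `[a, b]) f s
  else - \int[lebesgue_measure]_(s in `[b, a]) f s.

Definition norm_term (R : realType) (n : nat) (N : 'M[R[i]]_n -> R)
    (A B X : 'M[R[i]]_n) (r s t : R) : R :=
  N (mxpowR (mxabs (mxpowR A s *m X *m mxpowR B t)) r).

Definition mean_term (R : realType) (n : nat) (N : 'M[R[i]]_n -> R)
    (A B X : 'M[R[i]]_n) (r mu : R) : R :=
  `|1 - 2 * mu|^-1 *
  `|oriented_integral mu (1 - mu) (fun s =>
      norm_term N A B X r s (1 - s) * norm_term N A B X r (1 - s) s)|.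

Definition mean_term_ext (R : realType) (n : nat) (N : 'M[R[i]]_n -> R)
    (A B X : 'M[R[i]]_n) (r mu : R) : R :=
  if mu == 2^-1 then lim (mean_term N A B X r x @[x --> (2^-1 : R)^'])
  else mean_term N A B X r mu.

(* Main.v *)
Require Import Defs.
From HB Require Import structures.
From mathcomp Require Import all_boot all_order all_algebra fingroup perm.
From mathcomp Require Import sesquilinear spectral complex.
From mathcomp Require Import all_classical all_reals all_analysis.
From mathcomp Require Import measurable_realfun ring lra.

Set Implicit Arguments.
Unset Strict Implicit.
Unset Printing Implicit Defensive.

Import Order.TTheory GRing.Theory Num.Theory.
Import numFieldNormedType.Exports.

Local Open Scope ring_scope.
Local Open Scope sesquilinear_scope.

(** Write [g s] for the norm of |A^s X B^(1-s)|^r and [f s = g s * g (1 - s)].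
    The chain of inequalities is the Hermite-Hadamard inequality for [f] on the
    interval between [mu] and [1 - mu], where [f] is convex on the unit
    interval and symmetric about 1/2: its minimum is [f (1/2)], and on each
    half of the interval [f] lies below its chord.

    Convexity comes from a Cauchy-Schwarz inequality for unitarily invariant
    norms, [norm_CauchySchwarz]: if [E] and [F] are Hermitian and T = E Y F,
    P = E E Y, Q = Y F F, then the norm of |T|^r is at most the geometric mean
    of those of |P|^r and |Q|^r. With E = A^((t-s)/2), F = B^((t-s)/2) and
    Y = A^s X B^(1-t) these are the matrices of the path at the midpoint of
    [s] and [t], at [t] and at [s]; so [g] is midpoint log-convex and [f] is
    midpoint convex. As [f] is bounded, it is convex
    ([midpoint_convex_chord]), hence monotone on either side of 1/2, hence
    measurable. Boundedness stands in for continuity, which can fail at 0 and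
    1, where the zeroth power of a singular matrix is the identity.

    The Cauchy-Schwarz inequality rests on a majorization of singular values.
    Denote adjoints by primes. Since T'T = F (P' Y F) and P'Q = (P' Y F) F, an
    orthonormal k-frame [V] of eigenvectors of T'T with diagonal matrix of
    eigenvalues [L] is carried to Z = P' Y F V with P'Q Z = Z L. Hence
    det(Z'Z) det(L) = det((PZ)'(QZ)), and the Cauchy-Binet formula reduces a
    bound on the right-hand side to the usual Cauchy-Schwarz inequality. This
    gives [gram_log_majorization]: the product of the [k] largest squared
    singular values of [T] is at most the geometric mean of the corresponding
    products for [P] and [Q]. Inequalities between partial products imply the
    same between partial sums ([sum_le_of_prod_le]), also after taking powers,
    and a unitarily invariant norm, seen as a function of the singular values,
    respects these ([weak_majorization], the Ky Fan dominance principle). *)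

(** * Determinants of products and Gram matrices *)

Section Det.
Variable (K : comNzRingType).

Lemma det_mulmx_sum (k n : nat) (A : 'M[K]_(k, n)) (B : 'M[K]_(n, k)) :
  \det (A *m B) =
  \sum_(f : {ffun 'I_k -> 'I_n}) (\prod_i A i (f i)) * \det (rowsub f B).
Proof.
rewrite /determinant.
under eq_bigr => s _.
  under eq_bigr do rewrite mxE.
  rewrite (bigA_distr_bigA (fun i j => A i j * B j (s i))) /= mulr_sumr.
  under eq_bigr do rewrite big_split /= mulrCA.
  over.
rewrite exchange_big /=; apply: eq_bigr => f _.
rewrite mulr_sumr; apply: eq_bigr => s _.
by congr (_ * (_ * _)); apply: eq_bigr => i _; rewrite mxE.
Qed.

(** The sum ranges over all maps [f] instead of over k-subsets: maps that are
    not injective contribute 0, and every subset is counted [k`!] times, but no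
    ordering of its elements has to be chosen. *)
Lemma Cauchy_Binet (k n : nat) (A : 'M[K]_(k, n)) (B : 'M[K]_(n, k)) :
  \det (A *m B) *+ k`! =
  \sum_(f : {ffun 'I_k -> 'I_n}) \det (colsub f A) * \det (rowsub f B).
Proof.
(* Precomposing f with p permutes the rows of B, which costs the sign of p;
   averaging over p makes the determinant of colsub f A appear. *)
have perm_sum (p : 'S_k) : \det (A *m B) =
    \sum_(f : {ffun 'I_k -> 'I_n})
      ((-1) ^+ p * \prod_i A i (f (p i))) * \det (rowsub f B).
  rewrite det_mulmx_sum.
  rewrite (reindex (fun f : {ffun 'I_k -> 'I_n} => [ffun i => f (p i)])) /=; last first.
    exists (fun f : {ffun 'I_k -> 'I_n} => [ffun i => f ((p^-1)%g i)]) => f _;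
      by apply/ffunP => i; rewrite !ffunE ?permK ?permKV.
  apply: eq_bigr => f _.
  have -> : rowsub [ffun i => f (p i)] B = row_perm p (rowsub f B).
    by apply/matrixP => i j; rewrite !mxE ffunE.
  rewrite row_permE det_mulmx det_perm mulrA [_ * (-1) ^+ _]mulrC.
  by congr (_ * _ * _); apply: eq_bigr => i _; rewrite ffunE.

rewrite -[k`!](card_Sn k) -sumr_const.
under eq_bigr => p _ do rewrite (perm_sum p).
rewrite exchange_big /=; apply: eq_bigr => f _.
rewrite -mulr_suml; congr (_ * _); rewrite /determinant.
apply: eq_big => [p|p _]; first by rewrite inE.
by congr (_ * _); apply: eq_bigr => i _; rewrite mxE.
Qed.
End Det.

Section Gram.
Variable C : numClosedFieldType.

Lemma trmxC_mul (m n p : nat) (A : 'M[C]_(m, n)) (B : 'M[C]_(n, p)) :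
  (A *m B)^t* = B^t* *m A^t*.
Proof. by rewrite trmx_mul map_mxM. Qed.

Lemma mul_trmxC_unitary (n : nat) (U : 'M[C]_n) : U \is unitarymx -> U^t* *m U = 1%:M.
Proof. by move=> uU; rewrite -invmx_unitary // mulVmx // unitarymx_unit. Qed.

Lemma det_trmxC (n : nat) (A : 'M[C]_n) : \det (A^t*) = (\det A)^*.
Proof. by rewrite det_map_mx det_tr. Qed.

Lemma det_gram_sum (k n : nat) (E F : 'M[C]_(n, k)) :
  \det (E^t* *m F) *+ k`! =
  \sum_(f : {ffun 'I_k -> 'I_n}) (\det (rowsub f E))^* * \det (rowsub f F).
Proof.
rewrite Cauchy_Binet; apply: eq_bigr => f _; rewrite -det_trmxC.
by congr (\det _ * _); apply/matrixP => i j; rewrite !mxE.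
Qed.

Lemma CauchySchwarz_sum (I : finType) (x y : I -> C) :
  `|\sum_i (x i)^* * y i| ^+ 2 <= (\sum_i `|x i| ^+ 2) * (\sum_i `|y i| ^+ 2).
Proof.
pose u : 'rV[C]_#|I| := \row_i x (enum_val i).
pose v : 'rV[C]_#|I| := \row_i y (enum_val i).
have dotE (z w : I -> C) :
    dotmx (\row_i z (@enum_val I predT i)) (\row_i w (enum_val i)) = \sum_i (w i)^* * z i.
  rewrite dotmxE mxE (reindex (@enum_val I predT)) /=; last first.
    by apply: onW_bij; apply: enum_val_bij.
  by apply: eq_bigr => i _; rewrite !mxE mulrC.
have sqE (z : I -> C) : \sum_i `|z i| ^+ 2 = \sum_i (z i)^* * z i.
  by apply: eq_bigr => i _; rewrite mulrC -normCK.
rewrite !sqE mulrC -!dotE.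
exact: (leif_le (CauchySchwarz (@dotmx C #|I|) v u)).
Qed.

Lemma det_gram_ge0 (k n : nat) (E : 'M[C]_(n, k)) : 0 <= \det (E^t* *m E).
Proof.
have := det_gram_sum E E; rewrite -(pmulrn_lge0 _ (fact_gt0 k)) => ->.
by apply: sumr_ge0 => f _; rewrite mulrC -normCK exprn_ge0.
Qed.

(** By Cauchy-Binet, the determinant of E'F is the inner product of the
    vectors of maximal minors of [E] and [F]. *)
Lemma det_gram_CauchySchwarz (k n : nat) (E F : 'M[C]_(n, k)) :
  `|\det (E^t* *m F)| ^+ 2 <= \det (E^t* *m E) * \det (F^t* *m F).
Proof.
have k0 : 0 < (k`!)%:R ^+ 2 :> C by rewrite exprn_gt0 // ltr0n fact_gt0.
rewrite -(ler_pM2r k0) [in X in _ <= X]expr2 [in X in _ <= X]mulrACA.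
rewrite -[in X in X <= _](ger0_norm (ler0n C k`!)) -exprMn -normrM.
rewrite !mulr_natr !det_gram_sum.
under [X in _ <= X * _]eq_bigr do rewrite mulrC -normCK.
under [X in _ <= _ * X]eq_bigr do rewrite mulrC -normCK.
exact: CauchySchwarz_sum.
Qed.
End Gram.

Section SortedProd.
Variable (K : numDomainType).

(** The largest index in [S] is at least #|S| - 1, so its factor may be
    replaced by the one at that index; the rest follows by induction. *)
Lemma le_prod_sorted (n : nat) (a : 'I_n -> K) (S : {set 'I_n}) :
  (forall i, 0 <= a i) -> (forall i j : 'I_n, (i <= j)%N -> a j <= a i) ->
  \prod_(i in S) a i <= \prod_(i < n | (i < #|S|)%N) a i.
Proof.
move=> a0 adec; have [k Sk] : exists k, #|S| = k by exists #|S|.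
rewrite Sk; elim: k S Sk => [|k IH] S Sk.
  by move/cards0_eq: Sk => ->; rewrite !big_pred0 // => i; rewrite inE.
have /card_gt0P[i0 i0S] : (0 < #|S|)%N by rewrite Sk.
case: (@arg_maxnP _ i0 (mem S) (@nat_of_ord n) i0S) => m; rewrite -[mem S m]/(m \in S) => mS mmax.
have cardlt (j : nat) : (j <= n)%N -> #|[set i : 'I_n | (i < j)%N]| = j.
  move=> jn; have winj : injective (widen_ord jn).
    by move=> x y /(congr1 val) /= /val_inj.
  rewrite -[RHS]card_ord -(card_imset _ winj).
  apply: eq_card => i; rewrite inE; apply/idP/imsetP => [ij|[x _ ->]] /=.
    by exists (Ordinal ij) => //; apply: val_inj.
  exact: ltn_ord.
have km : (k <= m)%N.
  rewrite -ltnS -Sk -(cardlt m.+1) //.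
  by apply/subset_leq_card/fintype.subsetP => i /mmax; rewrite inE ltnS.
have kn : (k < n)%N := leq_ltn_trans km (ltn_ord m).
rewrite (big_setD1 m) //= [X in _ <= X](bigD1 (Ordinal kn)) //=.
apply: ler_pM => //; first by apply: prodr_ge0.
  exact: adec.
apply: le_trans (IH _ _) _.
  by apply/eqP; rewrite -eqSS -Sk (cardsD1 m S) mS.
rewrite le_eqVlt; apply/orP; left; apply/eqP; apply: eq_bigl => i.
by rewrite -val_eqE /= ltnS [RHS]andbC ltn_neqAle.
Qed.
End SortedProd.

Section LogMajorization.
Variable C : numClosedFieldType.

(** In the Cauchy-Binet expansion, the weight of each squared minor is a product
    of [k] distinct entries of [d], and the first [k] entries have the
    largest product. *)
Lemma det_gram_diag_le (k n : nat) (d : 'rV[C]_n) (G : 'M[C]_(n, k)) :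
  (forall i, 0 <= d 0 i) -> (forall i j : 'I_n, (i <= j)%N -> d 0 j <= d 0 i) ->
  \det (G^t* *m diag_mx d *m G) <=
  (\prod_(i < n | (i < k)%N) d 0 i) * \det (G^t* *m G).
Proof.
move=> d0 ddec; set p := \prod_(i < n | _) _.
have k0 : 0 < (k`!)%:R :> C by rewrite ltr0n fact_gt0.
rewrite -(ler_pM2r k0) -mulrA !mulr_natr -mulmxA !det_gram_sum mulr_sumr.
apply: ler_sum => f _.
have -> : rowsub f (diag_mx d *m G) =
    diag_mx (\row_i d 0 (f i)) *m rowsub f G.
  by apply/matrixP => i j; rewrite !mul_diag_mx !mxE.
rewrite det_mulmx det_diag mulrCA.
under eq_bigr do rewrite mxE.
have [finj|] := boolP (injectiveb f); last first.
  case/injectivePn => i [j ij fij].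
  rewrite [\det (rowsub f G)](determinant_alternate ij); last first.
    by move=> l; rewrite !mxE fij.
  by rewrite !mulr0.
apply: ler_wpM2r; first by rewrite mulrC -normCK exprn_ge0.
have -> : \prod_i d 0 (f i) = \prod_(i in f @: 'I_k) d 0 i.
  by rewrite big_imset //; apply: in2W; apply/injectiveP.
have := le_prod_sorted (f @: 'I_k) d0 ddec.
by rewrite card_imset ?card_ord //; apply/injectiveP.
Qed.

(** The matrices [U1], [U2], [U3] diagonalize the Gram matrices of T = E Y F,
    P = E E Y and Q = Y F F. If the product for [T] is nonzero, then the [k]
    top eigenvectors of T'T, transported by P' Y F, span an invariant subspace
    of P'Q with the same eigenvalues, and there the determinant of P'Q is
    controlled by Gram determinants of [P] and [Q]. *)
Lemma gram_log_majorization (n k : nat) (E F Y : 'M[C]_n)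
    (U1 U2 U3 : 'M[C]_n) (d1 d2 d3 : 'rV[C]_n) :
  E^t* = E -> F^t* = F ->
  U1 \is unitarymx -> U2 \is unitarymx -> U3 \is unitarymx ->
  (E *m Y *m F)^t* *m (E *m Y *m F) = U1^t* *m diag_mx d1 *m U1 ->
  (E *m E *m Y)^t* *m (E *m E *m Y) = U2^t* *m diag_mx d2 *m U2 ->
  (Y *m F *m F)^t* *m (Y *m F *m F) = U3^t* *m diag_mx d3 *m U3 ->
  (forall i, 0 <= d1 0 i) ->
  (forall i, 0 <= d2 0 i) -> (forall i j : 'I_n, (i <= j)%N -> d2 0 j <= d2 0 i) ->
  (forall i, 0 <= d3 0 i) -> (forall i j : 'I_n, (i <= j)%N -> d3 0 j <= d3 0 i) ->
  (k <= n)%N ->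
  (\prod_(i < n | (i < k)%N) d1 0 i) ^+ 2 <=
  (\prod_(i < n | (i < k)%N) d2 0 i) * (\prod_(i < n | (i < k)%N) d3 0 i).
Proof.
move=> hE hF u1 u2 u3 eT eP eQ d10 d20 d2dec d30 d3dec kn.
set p1 := \prod_(i < n | _) d1 0 i; set p2 := (X in _ <= X * _).
set p3 := (X in _ <= _ * X).
set T := E *m Y *m F in eT; set P := E *m E *m Y in eP; set Q := Y *m F *m F in eQ.
have p20 : 0 <= p2 by apply: prodr_ge0.
have p30 : 0 <= p3 by apply: prodr_ge0.
have [p10|p1n0] := eqVneq p1 0; first by rewrite p10 expr0n mulr_ge0.
(* J selects the first k coordinates, so V below consists of the k top
   eigenvectors of T'T. *)
pose J : 'M[C]_(n, k) := \matrix_(i, j) (i == widen_ord kn j)%:R.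
pose L : 'M[C]_k := diag_mx (\row_j d1 0 (widen_ord kn j)).
have JJ : J^t* *m J = 1%:M.
  apply/matrixP => i j; rewrite !mxE (bigD1 (widen_ord kn i)) //= !mxE eqxx.
  rewrite rmorph1 mul1r big1 ?addr0 => [|l li].
    by rewrite (inj_eq (_ : injective (widen_ord kn))) // => x y /(congr1 val) /= /val_inj.
  by rewrite !mxE (negPf li) rmorph0 mul0r.
have dJ : diag_mx d1 *m J = J *m L.
  apply/matrixP => i j; rewrite mul_diag_mx mul_mx_diag !mxE.
  by case: eqP => [->|]; rewrite ?mulr0 ?mul0r // mulr1 mul1r.
have detL : \det L = p1.
  rewrite det_diag /p1.
  rewrite [RHS](big_ord_narrow kn) /=.
  by apply: eq_bigr => i _; rewrite mxE.
pose V := U1^t* *m J.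
have VV : V^t* *m V = 1%:M.
  rewrite trmxC_mul trmxCK mulmxA -[_ *m U1 *m _]mulmxA.
  by rewrite (unitarymxP u1) mulmx1.
have TV : T^t* *m T *m V = V *m L.
  rewrite eT /V !mulmxA -[_ *m U1 *m _]mulmxA (unitarymxP u1) mulmx1.
  by rewrite -!mulmxA dJ.
pose Z := Y^t* *m E *m E *m Y *m F *m V.
have FZ : F *m Z = V *m L.
  by rewrite -TV /T /Z !trmxC_mul hE hF !mulmxA.
have PQZ : P^t* *m Q *m Z = Z *m L.
  rewrite -[LHS]mulmxA /Q -![_ *m F *m F *m Z]mulmxA FZ.
  by rewrite /P !trmxC_mul hE /Z !mulmxA.
clearbody Z; clearbody V L P Q T.
have detZ0 : 0 <= \det (Z^t* *m Z) by exact: det_gram_ge0.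
(* F Z = V L is of full rank, hence so is Z. *)
have detZ : \det (Z^t* *m Z) != 0.
  have := det_gram_CauchySchwarz (F *m V) Z.
  have -> : (F *m V)^t* *m Z = L.
    by rewrite trmxC_mul hF -mulmxA FZ mulmxA VV mul1mx.
  rewrite detL; apply: contraTneq => ->; rewrite mulr0.
  by apply: contra_neqN p1n0 => h; apply/eqP; rewrite -normr_eq0 -sqrf_eq0 eq_le h exprn_ge0.
have := det_gram_CauchySchwarz (P *m Z) (Q *m Z).
have -> : (P *m Z)^t* *m (Q *m Z) = Z^t* *m Z *m L.
  by rewrite trmxC_mul -[LHS]mulmxA [P^t* *m _]mulmxA PQZ mulmxA.
have gram_le (W U : 'M[C]_n) (d : 'rV[C]_n) : (forall i, 0 <= d 0 i) ->
    (forall i j : 'I_n, (i <= j)%N -> d 0 j <= d 0 i) -> U \is unitarymx ->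
    W^t* *m W = U^t* *m diag_mx d *m U ->
    \det ((W *m Z)^t* *m (W *m Z)) <=
    (\prod_(i < n | (i < k)%N) d 0 i) * \det (Z^t* *m Z).
  move=> d0 ddec uU eW; have := det_gram_diag_le (U *m Z) d0 ddec.
  have -> : (U *m Z)^t* *m (U *m Z) = Z^t* *m Z.
    rewrite trmxC_mul -!mulmxA [U^t* *m _]mulmxA.
    by rewrite mul_trmxC_unitary // mul1mx.
  suff -> : (U *m Z)^t* *m diag_mx d *m (U *m Z) = (W *m Z)^t* *m (W *m Z) by [].
  by rewrite !trmxC_mul -!mulmxA [W^t* *m _]mulmxA eW !mulmxA.
move=> CS; have := le_trans CS (ler_pM (det_gram_ge0 _) (det_gram_ge0 _)
  (gram_le _ _ _ d20 d2dec u2 eP) (gram_le _ _ _ d30 d3dec u3 eQ)).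
rewrite det_mulmx detL normrM (ger0_norm detZ0) (@ger0_norm _ p1); last first.
  exact: prodr_ge0.
rewrite exprMn [X in _ <= X -> _]mulrACA -expr2 mulrC ler_pM2r // exprn_gt0 //.
by rewrite lt_def detZ.
Qed.
End LogMajorization.

(** * Ky Fan dominance *)

Section WeakMajorization.
Variables (K : realFieldType) (n : nat) (Phi : ('I_n -> K) -> K).
Hypothesis Phi_convex : forall (t : K) (x y : 'I_n -> K), 0 <= t -> t <= 1 ->
  Phi (fun i => (1 - t) * x i + t * y i) <= (1 - t) * Phi x + t * Phi y.
Hypothesis Phi_tperm : forall (x : 'I_n -> K) (j k : 'I_n),
  Phi (fun i => x (tperm j k i)) = Phi x.
Hypothesis Phi_flip : forall (x : 'I_n -> K) (j : 'I_n),
  Phi (fun i => if i == j then - x i else x i) = Phi x.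

(** A transfer from a larger to a smaller entry by at most their difference is
    a convex combination of [x] and [x] with the two entries exchanged. *)
Let Phi_transfer (x : 'I_n -> K) (j k : 'I_n) (d : K) : j != k ->
  0 <= d -> d <= x j - x k ->
  Phi (fun i => x i + d * ((i == k)%:R - (i == j)%:R)) <= Phi x.
Proof.
move=> jk d0 dle.
have [xjk|xjk] := ltP 0 (x j - x k); last first.
  suff -> : d = 0 by under eq_fun do rewrite mul0r addr0.
  by lra.
pose t := d / (x j - x k).
have t0 : 0 <= t by rewrite divr_ge0 // ltW.
have t1 : t <= 1 by rewrite ler_pdivrMr // mul1r.
have -> : (fun i => x i + d * ((i == k)%:R - (i == j)%:R)) =
    (fun i => (1 - t) * x i + t * x (tperm j k i)).
  apply: funext => i; have dE : d = t * (x j - x k) by rewrite divfK // gt_eqF.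
  case: tpermP => [->|->|/eqP/negPf-> /eqP/negPf->].
  - by rewrite eqxx (negPf jk) dE /=; ring.
  - by rewrite eqxx eq_sym (negPf jk) dE /=; ring.
  - by rewrite subrr mulr0; ring.
by apply: le_trans (Phi_convex _ _ t0 t1) _; rewrite Phi_tperm; lra.
Qed.

(** The modified vector is a convex combination of [x] and [x] with the sign of
    one entry changed. *)
Let Phi_shrink (x : 'I_n -> K) (j : 'I_n) (c : K) : 0 <= c -> c <= x j ->
  Phi (fun i => if i == j then c else x i) <= Phi x.
Proof.
move=> c0 cx; have [xj|xj] := ltP 0 (x j); last first.
  suff -> : (fun i => if i == j then c else x i) = x by [].
  by apply: funext => i; case: eqP => // ->; apply/eqP; rewrite eq_le cx (le_trans xj c0).
pose t := (x j - c) / (2 * x j).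
have xj2 : 0 < 2 * x j by lra.
have t0 : 0 <= t by apply: divr_ge0; lra.
have t1 : t <= 1 by rewrite ler_pdivrMr // mul1r; lra.
have -> : (fun i => if i == j then c else x i) =
    (fun i => (1 - t) * x i + t * (if i == j then - x i else x i)).
  apply: funext => i; case: eqP => [->|_]; last by ring.
  by rewrite /t; field; rewrite gt_eqF.
by apply: le_trans (Phi_convex _ _ t0 t1) _; rewrite Phi_flip; lra.
Qed.

(** Induction on the number of entries where [x] and [y] differ. If some
    [y k < x k], take the first such [k]; the partial sums up to [k] provide an
    earlier [j] with [x j < y j], and a transfer from [j] to [k] makes [y]
    agree with [x] at one of the two, without spoiling the partial sums.
    Otherwise [x <= y], and entries of [y] are shrunk one at a time. *)
Theorem weak_majorization (x y : 'I_n -> K) :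
  (forall i, 0 <= x i) -> (forall i j : 'I_n, (i <= j)%N -> x j <= x i) ->
  (forall m : nat, (m <= n)%N ->
     \sum_(i < n | (i < m)%N) x i <= \sum_(i < n | (i < m)%N) y i) ->
  Phi x <= Phi y.
Proof.
move=> x0 xdec; have [d] := ubnP #|[pred i | x i != y i]|.
elim: d y => // d IH y; rewrite ltnS => dy xy.
have [/existsP[k0 yxk0]|] := boolP [exists k, y k < x k]; last first.
  rewrite negb_exists => /forallP xley; have {}xley i : x i <= y i.
    by rewrite leNgt; apply: xley.
  have [/existsP[j xyj]|] := boolP [exists j, x j != y j]; last first.
    rewrite negb_exists => /forallP xey.
    by rewrite (_ : x = y) //; apply: funext => i; apply/eqP; rewrite -[_ == _]negbK.
  apply: le_trans (Phi_shrink (x0 j) (xley j)).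
  apply: IH => [|m mn]; last first.
    by apply: ler_sum => i _; case: eqP => // ->.
  apply: leq_trans dy; apply: proper_card; apply/properP; split.
    by apply/fintype.subsetP => i; rewrite !inE; case: (i =P j) => [->|//]; rewrite eqxx.
  by exists j; rewrite !inE // !eqxx.
case: (@arg_minnP _ k0 (fun k => y k < x k) (@nat_of_ord n) yxk0) => k yxk kmin.
have xley (i : 'I_n) : (i < k)%N -> x i <= y i.
  by move=> ik; rewrite leNgt; apply/negP => /kmin; rewrite leqNgt ik.
have [/existsP[j /andP[jk xyj]]|] := boolP [exists j : 'I_n, (j < k)%N && (x j < y j)]; last first.
  rewrite negb_exists => /forallP noj.
  have := xy k.+1 (ltn_ord k); rewrite leNgt => /negP[].
  rewrite (bigD1 k) //= [X in _ < X](bigD1 k) //=.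
  apply: ltr_leD => //; apply: ler_sum => i /andP[ik ink].
  have {}ik : (i < k)%N by rewrite ltn_neqAle ink.
  by have := noj i; rewrite ik /= -leNgt.
have jnk : j != k by rewrite -val_eqE /= ltn_eqF.
pose e := Num.min (y j - x j) (x k - y k).
have e0 : 0 <= e by rewrite le_min !subr_ge0 !ltW.
have ej : e <= y j - x j by rewrite ge_min lexx.
have ek : e <= x k - y k by rewrite ge_min lexx orbT.
have xkj : x k <= x j by apply: xdec; apply: ltnW.
have edif : e <= y j - y k by lra.
apply: le_trans (Phi_transfer jnk e0 edif).
set y' := fun i => _.
have y'j : y' j = y j - e by rewrite /y' eqxx (negPf jnk) /=; ring.
have y'k : y' k = y k + e by rewrite /y' eqxx eq_sym (negPf jnk) /=; ring.
have y'E i : i != j -> i != k -> y' i = y i.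
  by move=> /negPf ij /negPf ik; rewrite /y' ij ik subrr mulr0 addr0.
apply: IH => [|m mn].
  apply: leq_trans dy; apply: proper_card; apply/properP; split.
    apply/fintype.subsetP => i; rewrite !inE.
    have [->|ij] := eqVneq i j; first by rewrite (lt_eqF xyj).
    have [->|ik] := eqVneq i k; first by rewrite (gt_eqF yxk).
    by rewrite y'E.
  have [le|lt] := leP (y j - x j) (x k - y k).
    exists j; rewrite !inE; first by rewrite (lt_eqF xyj).
    by rewrite y'j /e min_l // opprB addrCA subrr addr0 eqxx.
  exists k; rewrite !inE; first by rewrite (gt_eqF yxk).
  by rewrite y'k /e min_r ?ltW // addrC subrK eqxx.
have [mk|km] := leqP m k.
  apply: ler_sum => i im; have ik : (i < k)%N := leq_trans im mk.
  have [->|ij] := eqVneq i j; first by rewrite y'j; lra.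
  by rewrite y'E // ?xley // -val_eqE /= ltn_eqF.
apply: le_trans (xy m mn) _; rewrite big_split /= -mulr_sumr.
have ind (l : 'I_n) : (l < m)%N -> \sum_(i < n | (i < m)%N) (i == l)%:R = 1 :> K.
  move=> lm; rewrite (bigD1 l) //= eqxx big1 ?addr0 // => i /andP[_ /negPf ->] //.
by rewrite sumrB !ind ?(ltn_trans jk) // subrr mulr0 addr0.
Qed.
End WeakMajorization.

(** * From partial products to partial sums *)

Section LogToWeak.
Variable R : realType.

Lemma big_ord_ltS (T : Type) (idx : T) (op : Monoid.com_law idx) (n k : nat)
    (F : 'I_n -> T) (kn : (k < n)%N) :
  \big[op/idx]_(i < n | (i < k.+1)%N) F i =
  op (F (Ordinal kn)) (\big[op/idx]_(i < n | (i < k)%N) F i).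
Proof.
rewrite (bigD1 (Ordinal kn)) //=; congr (op _ _); apply: eq_bigl => i.
by rewrite -val_eqE /= ltnS andbC -ltn_neqAle.
Qed.

(** By summation by parts, the difference of the two sides is the sum of the
    partial sums of [c], weighted by the decrements of [w]. *)
Lemma Abel_sum_ge (n : nat) (w c : 'I_n -> R) :
  (forall i, 0 <= w i) -> (forall i j : 'I_n, (i <= j)%N -> w j <= w i) ->
  forall k (kn : (k < n)%N),
  (forall m, (m <= k.+1)%N -> 0 <= \sum_(i < n | (i < m)%N) c i) ->
  w (Ordinal kn) * \sum_(i < n | (i < k.+1)%N) c i <=
  \sum_(i < n | (i < k.+1)%N) w i * c i.
Proof.
move=> w0 wdec; elim=> [|k IH] kn c0.
  by rewrite !(big_ord_ltS _ _ kn) /= !big_pred0 // !addr0.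
have kn' : (k < n)%N := ltnW kn.
rewrite [X in _ * X](big_ord_ltS _ _ kn) [X in _ <= X](big_ord_ltS _ _ kn) /=.
rewrite mulrDr lerD2l; apply: le_trans (IH kn' _).
  by apply: ler_wpM2r; [apply: c0 | apply: wdec].
by move=> m mk; apply: c0; apply: ltnW.
Qed.

(** While [a] is positive, b - a >= a (ln b - ln a) entrywise, and the partial
    sums of [ln b - ln a] are nonnegative by assumption, so summation by parts
    with the weights [a] applies. Once [a] vanishes, nothing more is added on
    the left. *)
Lemma sum_le_of_prod_le (n : nat) (a b : 'I_n -> R) :
  (forall i, 0 <= a i) -> (forall i j : 'I_n, (i <= j)%N -> a j <= a i) ->
  (forall i, 0 <= b i) ->
  (forall k, (k <= n)%N ->
    \prod_(i < n | (i < k)%N) a i <= \prod_(i < n | (i < k)%N) b i) ->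
  forall k, (k <= n)%N ->
    \sum_(i < n | (i < k)%N) a i <= \sum_(i < n | (i < k)%N) b i.
Proof.
move=> a0 adec b0 ab; elim=> [|k IH] kn; first by rewrite !big_pred0.
have [ak0|ak] := leP (a (Ordinal kn)) 0.
  rewrite !(big_ord_ltS _ _ kn); apply: lerD (IH (ltnW kn)).
  exact: le_trans ak0 (b0 _).
have apos (i : 'I_n) : (i < k.+1)%N -> 0 < a i.
  by move=> ik; apply: lt_le_trans ak (adec _ _ _).
have bpos (i : 'I_n) : (i < k.+1)%N -> 0 < b i.
  move=> ik; rewrite lt_def b0 andbT.
  apply: contraTneq (ab _ kn) => bi0.
  by rewrite [X in _ <= X](bigD1 i) //= bi0 mul0r -ltNge prodr_gt0.
pose c i := ln (b i) - ln (a i).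
have lnprod (x : 'I_n -> R) m : (forall i : 'I_n, (i < k.+1)%N -> 0 < x i) ->
    (m <= k.+1)%N -> \sum_(i < n | (i < m)%N) ln (x i) =
    ln (\prod_(i < n | (i < m)%N) x i) /\ 0 < \prod_(i < n | (i < m)%N) x i.
  move=> xpos mk; split; last first.
    by apply: prodr_gt0 => i im; apply/xpos/(leq_trans im).
  elim: m mk => [|m IHm] mk; first by rewrite !big_pred0 // ln1.
  have mn : (m < n)%N := leq_trans mk kn.
  rewrite !(big_ord_ltS _ _ mn) lnM ?IHm ?(ltnW mk) //= posrE ?xpos //.
  by apply: prodr_gt0 => i im; apply/xpos/(ltn_trans im).
have c0 m : (m <= k.+1)%N -> 0 <= \sum_(i < n | (i < m)%N) c i.
  move=> mk; rewrite sumrB; have [-> pa] := lnprod _ _ apos mk.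
  have [-> pb] := lnprod _ _ bpos mk.
  by rewrite subr_ge0 ler_ln ?posrE // ab // (leq_trans mk).
rewrite -subr_ge0 -sumrB.
apply: le_trans (_ : \sum_(i < n | (i < k.+1)%N) a i * c i <= _).
  have := Abel_sum_ge a0 adec kn c0; apply: le_trans.
  by rewrite mulr_ge0 // c0.
apply: ler_sum => i ik; have ai := apos i ik; have bi := bpos i ik.
have -> : b i - a i = a i * (b i / a i - 1) by field; rewrite gt_eqF.
rewrite ler_pM2l // /c -ln_div ?posrE //.
have := @le_ln1Dx R (b i / a i - 1); rewrite addrCA subrr addr0; apply.
have : 0 < b i / a i by rewrite divr_gt0.
by lra.
Qed.

End LogToWeak.

(** * Functional calculus on Hermitian matrices *)

Section UnitaryDiagonalization.
Variable C : numClosedFieldType.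

(** Entrywise, the hypothesis says that [a] and [b] agree wherever [Q] does not
    vanish. *)
Lemma diag_intertwine (n : nat) (g : C -> C) (Q : 'M[C]_n) (a b : 'rV[C]_n) :
  Q *m diag_mx a = diag_mx b *m Q ->
  Q *m diag_mx (map_mx g a) = diag_mx (map_mx g b) *m Q.
Proof.
move=> /matrixP QE; apply/matrixP => i j; have := QE i j.
rewrite !mul_diag_mx !mul_mx_diag !mxE /= => Qij; rewrite [RHS]mulrC.
have [->|Q0] := eqVneq (Q i j) 0; first by rewrite !mul0r.
by move: Qij; rewrite [RHS]mulrC => /(mulfI Q0) ->.
Qed.

(** This makes functional calculus independent of the diagonalization, and lets
    [mxcalc] be computed in any orthonormal eigenbasis. *)
Lemma unitary_diag_calc_unique (n : nat) (g : C -> C) (S U : 'M[C]_n)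
    (s a : 'rV[C]_n) : S \is unitarymx -> U \is unitarymx ->
  S^t* *m diag_mx s *m S = U^t* *m diag_mx a *m U ->
  S^t* *m diag_mx (map_mx g s) *m S = U^t* *m diag_mx (map_mx g a) *m U.
Proof.
move=> uS uU E; pose Q := S *m U^t*.
have /(diag_intertwine g) : Q *m diag_mx a = diag_mx s *m Q.
  have : S *m (U^t* *m diag_mx a *m U) *m U^t* =
         S *m (S^t* *m diag_mx s *m S) *m U^t* by rewrite E.
  rewrite /Q !mulmxA (unitarymxP uS) mul1mx.
  by rewrite -[_ *m U *m U^t*]mulmxA (unitarymxP uU) mulmx1.
rewrite /Q => QE.
have : S^t* *m (S *m U^t* *m diag_mx (map_mx g a)) *m U =
       S^t* *m (diag_mx (map_mx g s) *m (S *m U^t*)) *m U by rewrite QE.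
rewrite !mulmxA mul_trmxC_unitary // mul1mx => ->.
by rewrite -[_ *m U^t* *m U]mulmxA mul_trmxC_unitary // mulmx1.
Qed.

Lemma hermsymmxE (n : nat) (A : 'M[C]_n) : (A \is hermsymmx) = (A^t* == A).
Proof. by rewrite is_hermitianmxE expr0 scale1r eq_sym. Qed.

Lemma hermitian_spectral (n : nat) (A : 'M[C]_n) : A^t* = A ->
  A = (spectralmx A)^t* *m diag_mx (spectral_diag A) *m spectralmx A.
Proof.
move=> hA; have hA' : A \is hermsymmx by rewrite hermsymmxE hA.
have /orthomx_spectralP := hermitian_normalmx hA'.
by rewrite invmx_unitary ?spectral_unitarymx.
Qed.

Lemma psd_spectral_diag_ge0 (n : nat) (A : 'M[C]_n) : A^t* = A ->
  (forall v : 'cV[C]_n, 0 <= (v ^t* *m A *m v) 0 0) ->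
  forall i, 0 <= spectral_diag A 0 i.
Proof.
move=> hA A0 i; have uS := spectral_unitarymx A; have eA := hermitian_spectral hA.
move: (spectralmx A) (spectral_diag A) uS eA => S s uS eA.
have := A0 (S^t* *m delta_mx i 0).
rewrite {1}eA trmxC_mul trmxCK !mulmxA.
rewrite -[_ *m S *m S^t*]mulmxA (unitarymxP uS) mulmx1.
rewrite -[_ *m S *m S^t*]mulmxA (unitarymxP uS) mulmx1.
rewrite -colE mxE -map_trmx map_delta_mx trmx_delta -rowE mxE.
by rewrite mxE eqxx mulr1n.
Qed.

Lemma perm_mx_unitary (n : nat) (p : 'S_n) : (perm_mx p : 'M[C]_n) \is unitarymx.
Proof.
by apply/unitarymxP; rewrite tr_perm_mx map_perm_mx -perm_mxM mulgV perm_mx1.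
Qed.

Lemma diag_mx_perm (n : nat) (p : 'S_n) (a : 'rV[C]_n) :
  diag_mx (\row_i a 0 (p i)) = perm_mx p *m diag_mx a *m (perm_mx p)^t*.
Proof.
rewrite tr_perm_mx map_perm_mx -row_permE; apply/matrixP => i j.
rewrite -[p in (p^-1)%g]invgK -col_permE !mxE invgK.
by rewrite (inj_eq perm_inj).
Qed.

Lemma unitary_conj_change (n : nat) (D U P : 'M[C]_n) : P \is unitarymx ->
  U^t* *m D *m U = (P *m U)^t* *m (P *m D *m P^t* ) *m (P *m U).
Proof.
move=> /mul_trmxC_unitary PP; rewrite trmxC_mul !mulmxA.
by rewrite -[_ *m P^t* *m P]mulmxA PP mulmx1 -[_ *m P^t* *m P]mulmxA PP mulmx1.
Qed.

Lemma gram_psd (n : nat) (T : 'M[C]_n) (v : 'cV[C]_n) :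
  0 <= (v ^t* *m (T^t* *m T) *m v) 0 0.
Proof.
rewrite mulmxA -trmxC_mul -mulmxA mxE; apply: sumr_ge0 => i _.
by rewrite 2!mxE mulrC -normCK exprn_ge0.
Qed.
End UnitaryDiagonalization.

Lemma exists_sorting_perm (R : realDomainType) (n : nat) (a : 'I_n -> R) :
  exists p : 'S_n, forall i j : 'I_n, (i <= j)%N -> a (p j) <= a (p i).
Proof.
pose t := [tuple a i | i < n].
have /tuple_permP[p tp] : perm_eq (sort (fun x y => y <= x) t) t.
  by rewrite perm_sort.
exists p => i j ij.
have srt : sorted (fun x y : R => y <= x) [tuple tnth t (p i) | i < n].
  by rewrite -tp; apply: sort_sorted => x y; apply: le_total.
have tr : transitive (fun x y : R => y <= x).
  by move=> x y z xy /le_trans; apply.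
have rf : reflexive (fun x y : R => y <= x) by move=> x; apply: lexx.
have := sorted_leq_nth tr rf 0 srt i j.
rewrite !inE size_tuple !ltn_ord => /(_ isT isT ij).
by rewrite -!tnth_nth !tnth_mktuple.
Qed.

Section RealDiagonal.
Variable R : realType.
Local Notation C := R[i].
Local Notation toC := (real_complex R).

Definition rdiag (n : nat) (a : 'I_n -> R) : 'M[C]_n :=
  diag_mx (\row_i toC (a i)).

Lemma rdiagM (n : nat) (a b : 'I_n -> R) :
  rdiag a *m rdiag b = rdiag (fun i => a i * b i).
Proof.
by apply/matrixP => i j; rewrite mul_diag_mx !mxE rmorphM mulrnAr.
Qed.

Lemma rdiag_trC (n : nat) (a : 'I_n -> R) : (rdiag a)^t* = rdiag a.
Proof.
apply/matrixP => i j; rewrite !mxE rmorphMn /= [j == i]eq_sym.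
case: eqP => [->|//]; congr (_ *+ _).
by apply/CrealP/complex_realP; exists (a j).
Qed.

Lemma rdiag_perm (n : nat) (p : 'S_n) (a : 'I_n -> R) :
  rdiag (fun i => a (p i)) = perm_mx p *m rdiag a *m (perm_mx p)^t*.
Proof.
rewrite -diag_mx_perm /rdiag.
congr diag_mx; apply/rowP => i; rewrite 3!mxE.
by [].
Qed.

Lemma mxcalc_rdiag (n : nat) (f : R -> R) (U : 'M[C]_n) (a : 'I_n -> R) :
  U \is unitarymx ->
  mxcalc f (U^t* *m rdiag a *m U) = U^t* *m rdiag (fun i => f (a i)) *m U.
Proof.
move=> uU; have hA : (U^t* *m rdiag a *m U)^t* = U^t* *m rdiag a *m U.
  by rewrite !trmxC_mul trmxCK rdiag_trC mulmxA.
have := hermitian_spectral hA; have := spectral_unitarymx (U^t* *m rdiag a *m U).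
rewrite /mxcalc; move: (spectralmx _) (spectral_diag _) => S s uS /esym E.
rewrite (invmx_unitary uS) (unitary_diag_calc_unique _ uS uU E) /rdiag.
have aE : map_mx (fun z : C => toC (f (complex.Re z))) (\row_i toC (a i)) =
    \row_i toC (f (a i)) by apply/rowP => i; rewrite !mxE.
rewrite aE; exact: erefl.
Qed.

Lemma psd_rdiag (n : nat) (A : 'M[C]_n) : A^t* = A ->
  (forall v : 'cV[C]_n, 0 <= (v ^t* *m A *m v) 0 0) ->
  exists U : 'M[C]_n, exists a : 'I_n -> R,
    [/\ U \is unitarymx, forall i, 0 <= a i & A = U^t* *m rdiag a *m U].
Proof.
move=> hA A0; have s0 := psd_spectral_diag_ge0 hA A0.
have := hermitian_spectral hA; have := spectral_unitarymx A.
move: (spectralmx _) (spectral_diag _) s0 => S s s0 uS eA.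
have sE i : toC (complex.Re (s 0 i)) = s 0 i by rewrite RRe_real // ger0_real.
exists S, (fun i => complex.Re (s 0 i)); split; first exact: uS.
  by move=> i; rewrite -ler0c sE.
have sE' : \row_i toC (complex.Re (s 0 i)) = s by apply/rowP => i; rewrite mxE sE.
by rewrite /rdiag sE'.
Qed.

Lemma psd_rdiag_sorted (n : nat) (A : 'M[C]_n) : A^t* = A ->
  (forall v : 'cV[C]_n, 0 <= (v ^t* *m A *m v) 0 0) ->
  exists U : 'M[C]_n, exists a : 'I_n -> R,
    [/\ U \is unitarymx, forall i, 0 <= a i,
        forall i j : 'I_n, (i <= j)%N -> a j <= a i
      & A = U^t* *m rdiag a *m U].
Proof.
move=> hA A0; have [U [a [uU a0 ->]]] := psd_rdiag hA A0.
have [p pdec] := exists_sorting_perm a.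
exists (perm_mx p *m U), (fun i => a (p i)); split.
- exact: (mul_unitarymx (perm_mx_unitary C p) uU).
- by move=> i; apply: a0.
- exact: pdec.
rewrite rdiag_perm; exact: (unitary_conj_change _ _ (perm_mx_unitary C p)).
Qed.

End RealDiagonal.

Section Powers.
Variable R : realType.
Local Notation C := R[i].

Lemma mxpowR_rdiag (n : nat) (U : 'M[C]_n) (a : 'I_n -> R) (s : R) :
  U \is unitarymx ->
  mxpowR (U^t* *m rdiag a *m U) s = U^t* *m rdiag (fun i => a i `^ s) *m U.
Proof. by move=> uU; rewrite /mxpowR mxcalc_rdiag. Qed.

Lemma psdmx_rdiag (n : nat) (A : 'M[C]_n) : psdmx A ->
  exists U : 'M[C]_n, exists a : 'I_n -> R,
    [/\ U \is unitarymx, forall i, 0 <= a i & A = U^t* *m rdiag a *m U].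
Proof.
by case; rewrite hermsymmxE => /eqP hA A0; exact: psd_rdiag hA A0.
Qed.

Lemma mxpowR_trC (n : nat) (A : 'M[C]_n) (s : R) : psdmx A ->
  (mxpowR A s)^t* = mxpowR A s.
Proof.
move=> /psdmx_rdiag[U [a [uU _ ->]]]; rewrite (mxpowR_rdiag _ _ uU).
by rewrite !trmxC_mul trmxCK rdiag_trC mulmxA.
Qed.

Lemma mxpowRD (n : nat) (A : 'M[C]_n) (s t : R) : psdmx A -> 0 <= s -> 0 <= t ->
  mxpowR A (s + t) = mxpowR A s *m mxpowR A t.
Proof.
move=> /psdmx_rdiag[U [a [uU a0 ->]]] s0 t0; rewrite !(mxpowR_rdiag _ _ uU).
rewrite -!mulmxA [U *m _]mulmxA (unitarymxP uU) mul1mx.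
rewrite [rdiag _ *m (_ *m _)]mulmxA rdiagM.
suff -> : (fun i => a i `^ (s + t)) = (fun i => a i `^ s * a i `^ t) by exact: erefl.
(* At the base 0, powRD excludes exponents with sum zero. *)
apply: funext => i; have [st0|st0] := eqVneq (s + t) 0; last first.
  by apply: powRD; rewrite (negPf st0).
have -> : s = 0 by lra.
have -> : t = 0 by lra.
by rewrite addr0 !powRr0 mulr1.
Qed.

Lemma singular_values (n : nat) (T : 'M[C]_n) :
  exists U : 'M[C]_n, exists a : 'I_n -> R,
    [/\ U \is unitarymx, forall i, 0 <= a i,
        forall i j : 'I_n, (i <= j)%N -> a j <= a i
      & T^t* *m T = U^t* *m rdiag a *m U].
Proof.
apply: psd_rdiag_sorted => [|v]; first by rewrite trmxC_mul trmxCK.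
exact: gram_psd.
Qed.

Lemma mxabs_pow_rdiag (n : nat) (T U : 'M[C]_n) (a : 'I_n -> R) (r : R) :
  U \is unitarymx -> T^t* *m T = U^t* *m rdiag a *m U ->
  mxpowR (mxabs T) r =
  U^t* *m rdiag (fun i => (a i `^ 2^-1) `^ r) *m U.
Proof.
move=> uU TE; rewrite /mxabs TE !(mxpowR_rdiag _ _ uU); exact: erefl.
Qed.
End Powers.

(** * Unitarily invariant norms as gauges of singular values *)

Section UnitarilyInvariantNorm.
Variables (R : realType) (n : nat) (N : 'M[R[i]]_n -> R).
Hypotheses (hN : is_mxnorm N) (hNU : unitarily_invariant N).
Local Notation C := R[i].
Local Notation toC := (real_complex R).

(** The symmetric gauge function of the norm [N], whose values at vectors of
    singular values determine [N]. *)
Definition gauge (x : 'I_n -> R) : R := N (rdiag x).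

Lemma norm_unitary_conj (U D : 'M[C]_n) : U \is unitarymx ->
  N (U^t* *m D *m U) = N D.
Proof. by move=> uU; rewrite hNU ?trmxC_unitary. Qed.

Lemma mxnorm_scale_real (c : R) (T : 'M[C]_n) : 0 <= c -> N (toC c *: T) = c * N T.
Proof.
case: hN => _ hZ _ c0; rewrite hZ; congr (_ * _).
by rewrite ger0_norm // ler0c.
Qed.

Lemma mxnorm_ge0 (T : 'M[C]_n) : 0 <= N T.
Proof.
case: hN => tri hZ _; have := tri T (-1 *: T).
rewrite hZ normrN normr1 /= mul1r scaleN1r subrr.
have := hZ 0 0; rewrite scaler0 normr0 /= mul0r => ->.
by lra.
Qed.

Lemma gauge_lincomb (s t : R) (x y : 'I_n -> R) : 0 <= s -> 0 <= t ->
  gauge (fun i => s * x i + t * y i) <= s * gauge x + t * gauge y.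
Proof.
move=> s0 t0; rewrite /gauge -!mxnorm_scale_real //.
case: hN => tri _ _; apply: le_trans (tri _ _).
suff -> : rdiag (fun i => s * x i + t * y i) =
  toC s *: rdiag x + toC t *: rdiag y by [].
by apply/matrixP => i j; rewrite !mxE rmorphD !rmorphM !mulrnAr mulrnDl.
Qed.

Lemma gauge_perm (p : 'S_n) (x : 'I_n -> R) :
  gauge (fun i => x (p i)) = gauge x.
Proof.
have uP := perm_mx_unitary C p.
by rewrite /gauge rdiag_perm hNU ?trmxC_unitary.
Qed.

Lemma gauge_flip (j : 'I_n) (x : 'I_n -> R) :
  gauge (fun i => if i == j then - x i else x i) = gauge x.
Proof.
(* The sign change is multiplication by a unitary diagonal matrix. *)
pose e i : R := if i == j then -1 else 1.
have ee : rdiag e *m rdiag e = 1%:M.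
  rewrite rdiagM; apply/matrixP => k l; rewrite !mxE /e.
  by case: (k == j); rewrite ?mulrNN mulr1.
have uE : rdiag e \is unitarymx by apply/unitarymxP; rewrite rdiag_trC.
have u1 : (1%:M : 'M[C]_n) \is unitarymx.
  by apply/unitarymxP; rewrite trmx1 map_mx1 mulmx1.
have -> : gauge x = N (rdiag e *m rdiag x *m 1%:M) by rewrite (hNU _ uE u1).
rewrite mulmx1 rdiagM /gauge; congr (N (rdiag _)); apply: funext => i; rewrite /e.
by case: eqP; rewrite ?mulN1r ?mul1r.
Qed.

Lemma gauge_weak_majorization (x y : 'I_n -> R) :
  (forall i, 0 <= x i) -> (forall i j : 'I_n, (i <= j)%N -> x j <= x i) ->
  (forall m : nat, (m <= n)%N ->
     \sum_(i < n | (i < m)%N) x i <= \sum_(i < n | (i < m)%N) y i) ->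
  gauge x <= gauge y.
Proof.
apply: weak_majorization => [t a b t0 t1|a j k|a j].
- by apply: gauge_lincomb; rewrite ?subr_ge0.
- exact: gauge_perm.
- exact: gauge_flip.
Qed.

Lemma sqrt_mul_le_AM (p q t : R) : 0 <= p -> 0 <= q -> 0 < t ->
  Num.sqrt (p * q) <= 2^-1 * t * p + 2^-1 * t^-1 * q.
Proof.
move=> p0 q0 t0; set u := 2^-1 * t * p; set v := 2^-1 * t^-1 * q.
have u0 : 0 <= u by rewrite !mulr_ge0 ?invr_ge0 // ltW.
have v0 : 0 <= v by rewrite !mulr_ge0 ?invr_ge0 // ltW.
have -> : p * q = 4 * u * v by rewrite /u /v; field; rewrite gt_eqF.
rewrite -[X in _ <= X]ger0_norm ?addr_ge0 // -sqrtr_sqr ler_wsqrtr //.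
by rewrite -subr_ge0 (_ : _ - _ = (u - v) ^+ 2) ?sqr_ge0 //; ring.
Qed.

(** The geometric mean is the infimum over [t] of these arithmetic means; for
    [b = 0] the infimum is approached as [t] tends to 0. *)
Lemma sqr_le_mul_of_AM (z a b : R) : 0 <= z -> 0 <= a -> 0 <= b ->
  (forall t, 0 < t -> z <= 2^-1 * t * a + 2^-1 * t^-1 * b) -> z ^+ 2 <= a * b.
Proof.
move=> z0 a0 b0 h; have [z1|zpos] := leP z 0.
  have -> : z = 0 by lra.
  by rewrite expr0n /= mulr_ge0.
have [b1|bpos] := leP b 0.
  have {b1} b00 : b = 0 by lra.
  (* Any t with t * a < 2 * z contradicts the hypothesis. *)
  have t0 : 0 < z / (a + 1) by rewrite divr_gt0 //; lra.
  have := h _ t0; rewrite b00 mulr0 addr0 => h'.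
  have : z / (a + 1) * a <= z.
    by rewrite mulrAC ler_pdivrMr ?ler_wpM2l //; lra.
  by lra.
(* The optimal t would be sqrt (b / a); t = b / z gives the bound at once. *)
have := h _ (divr_gt0 bpos zpos).
have -> : 2^-1 * (b / z) * a + 2^-1 * (b / z)^-1 * b = 2^-1 * (a * b / z) + 2^-1 * z.
  by field; rewrite !gt_eqF.
move=> h'; have : z <= a * b / z by lra.
by rewrite ler_pdivlMr // expr2.
Qed.

Lemma norm_mxabs_pow (T U : 'M[C]_n) (a : 'I_n -> R) (r : R) :
  U \is unitarymx -> T^t* *m T = U^t* *m rdiag a *m U ->
  N (mxpowR (mxabs T) r) = gauge (fun i => (a i `^ 2^-1) `^ r).
Proof.
by move=> uU TE; rewrite (mxabs_pow_rdiag _ uU TE) norm_unitary_conj.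
Qed.

(** Partial products of the powers of [d1] are dominated by those of the
    geometric means of the powers of [d2] and [d3], hence so are partial sums.
    Replacing the geometric means by weighted arithmetic ones makes the gauge
    subadditivity applicable, and the weights are optimized at the end. *)
Lemma gauge_log_majorization (d1 d2 d3 : 'I_n -> R) (r : R) : 0 <= r ->
  (forall i, 0 <= d1 i) -> (forall i j : 'I_n, (i <= j)%N -> d1 j <= d1 i) ->
  (forall i, 0 <= d2 i) -> (forall i, 0 <= d3 i) ->
  (forall k, (k <= n)%N -> (\prod_(i < n | (i < k)%N) d1 i) ^+ 2 <=
    (\prod_(i < n | (i < k)%N) d2 i) * (\prod_(i < n | (i < k)%N) d3 i)) ->
  gauge (fun i => (d1 i `^ 2^-1) `^ r) ^+ 2 <=
  gauge (fun i => (d2 i `^ 2^-1) `^ r) * gauge (fun i => (d3 i `^ 2^-1) `^ r).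
Proof.
move=> r0 d10 d1dec d20 d30 maj.
pose h (x : R) := (x `^ 2^-1) `^ r.
have h0 x : 0 <= h x by exact: powR_ge0.
have hM x y : 0 <= x -> 0 <= y -> h (x * y) = h x * h y.
  by move=> x0 y0; rewrite /h !powRM // powR_ge0.
have hle x y : 0 <= x -> x <= y -> h x <= h y.
  move=> x0 xy; have y0 := le_trans x0 xy.
  apply: ge0_ler_powR; rewrite ?nnegrE ?powR_ge0 //.
  by apply: ge0_ler_powR; rewrite ?nnegrE // invr_ge0.
have hprod (d : 'I_n -> R) k : (forall i, 0 <= d i) ->
    h (\prod_(i < n | (i < k)%N) d i) = \prod_(i < n | (i < k)%N) h (d i).
  move=> d0.
  have h1 : h 1 = 1 by rewrite /h !powR1.
  have [] : 0 <= \prod_(i < n | (i < k)%N) d i /\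
    h (\prod_(i < n | (i < k)%N) d i) = \prod_(i < n | (i < k)%N) h (d i); last by [].
  apply: (big_ind2 (fun x y => 0 <= x /\ h x = y)) => [|x1 y1 x2 y2 [x10 <-] [x20 <-]|i _].
  - by rewrite ler01.
  - by rewrite mulr_ge0 // hM.
  - by rewrite d0.
pose b i := Num.sqrt (h (d2 i) * h (d3 i)).
have sum_le k : (k <= n)%N ->
    \sum_(i < n | (i < k)%N) h (d1 i) <= \sum_(i < n | (i < k)%N) b i.
  apply: sum_le_of_prod_le => [i|i j ij|i|{}k kn].
  - exact: h0.
  - by apply: hle; [exact: d10|exact: d1dec].
  - exact: sqrtr_ge0.
  rewrite -(ler_pXn2r (ltn0Sn 1)) ?nnegrE; first last.
  - by apply: prodr_ge0 => i _; exact: sqrtr_ge0.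
  - exact: prodr_ge0.
  rewrite -hprod // expr2 -hM ?prodr_ge0 // -expr2.
  apply: le_trans (hle _ _ _ (maj k kn)) _; first by rewrite exprn_ge0 ?prodr_ge0.
  rewrite hM ?prodr_ge0 // !hprod // -big_split -prodrXl.
  rewrite le_eqVlt; apply/orP; left; apply/eqP; apply: eq_bigr => i _ /=.
  by rewrite sqr_sqrtr // mulr_ge0.
apply: sqr_le_mul_of_AM; rewrite ?mxnorm_ge0 // => t t0.
have s0 : 0 <= 2^-1 * t by rewrite mulr_ge0 ?invr_ge0 // ltW.
have s0' : 0 <= 2^-1 * t^-1 by rewrite mulr_ge0 ?invr_ge0 // ltW.
apply: le_trans (gauge_lincomb _ _ s0 s0').
apply: gauge_weak_majorization => [i|i j ij|m mn].
- exact: h0.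
- by apply: hle; [exact: d10|exact: d1dec].
apply: le_trans (sum_le m mn) _; apply: ler_sum => i _.
exact: sqrt_mul_le_AM.
Qed.

Lemma norm_log_majorization (T P Q U1 U2 U3 : 'M[C]_n) (d1 d2 d3 : 'I_n -> R)
    (r : R) : 0 <= r ->
  U1 \is unitarymx -> U2 \is unitarymx -> U3 \is unitarymx ->
  T^t* *m T = U1^t* *m rdiag d1 *m U1 ->
  P^t* *m P = U2^t* *m rdiag d2 *m U2 ->
  Q^t* *m Q = U3^t* *m rdiag d3 *m U3 ->
  (forall i, 0 <= d1 i) -> (forall i j : 'I_n, (i <= j)%N -> d1 j <= d1 i) ->
  (forall i, 0 <= d2 i) -> (forall i, 0 <= d3 i) ->
  (forall k, (k <= n)%N -> (\prod_(i < n | (i < k)%N) d1 i) ^+ 2 <=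
    (\prod_(i < n | (i < k)%N) d2 i) * (\prod_(i < n | (i < k)%N) d3 i)) ->
  N (mxpowR (mxabs T) r) ^+ 2 <= N (mxpowR (mxabs P) r) * N (mxpowR (mxabs Q) r).
Proof.
move=> r0 u1 u2 u3 e1 e2 e3 d10 d1dec d20 d30 maj.
have transport (x y z x' y' z' : R) : x = x' -> y = y' -> z = z' ->
  x' ^+ 2 <= y' * z' -> x ^+ 2 <= y * z by move=> -> -> ->.
exact: (transport _ _ _ _ _ _ (norm_mxabs_pow r u1 e1) (norm_mxabs_pow r u2 e2)
  (norm_mxabs_pow r u3 e3) (gauge_log_majorization r0 d10 d1dec d20 d30 maj)).
Qed.

(** The norms depend only on the eigenvalues of the three Gram matrices, which
    [gram_log_majorization] compares. *)
Lemma norm_CauchySchwarz (E F Y : 'M[C]_n) (r : R) : 0 <= r ->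
  E^t* = E -> F^t* = F ->
  N (mxpowR (mxabs (E *m Y *m F)) r) ^+ 2 <=
  N (mxpowR (mxabs (E *m E *m Y)) r) * N (mxpowR (mxabs (Y *m F *m F)) r).
Proof.
move=> r0 hE hF.
have [U1 [d1 [u1 d10 d1dec e1]]] := singular_values (E *m Y *m F).
have [U2 [d2 [u2 d20 d2dec e2]]] := singular_values (E *m E *m Y).
have [U3 [d3 [u3 d30 d3dec e3]]] := singular_values (Y *m F *m F).
have rowE0 (d : 'I_n -> R) i : (\row_i toC (d i)) 0 i = toC (d i).
  by rewrite mxE.
apply: (norm_log_majorization r0 u1 u2 u3 e1 e2 e3 d10 d1dec d20 d30) => k kn.
have := @gram_log_majorization C n k E F Y U1 U2 U3 _ _ _ hE hF u1 u2 u3 e1 e2 e3.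
have prodE (d : 'I_n -> R) :
    \prod_(i < n | (i < k)%N) (\row_i toC (d i)) 0 i =
    toC (\prod_(i < n | (i < k)%N) d i).
  by rewrite rmorph_prod; apply: eq_bigr => i _; rewrite mxE.
rewrite !prodE -rmorphXn -rmorphM lecR; apply=> // [i|i|i j ij|i|i j ij].
- by rewrite rowE0 ler0c.
- by rewrite rowE0 ler0c.
- by rewrite !rowE0 lecR d2dec.
- by rewrite rowE0 ler0c.
- by rewrite !rowE0 lecR d3dec.
Qed.
End UnitarilyInvariantNorm.

(** * The norms along the path of powers *)

Section BoundedEntries.
Variables (I : Type) (P : I -> Prop) (C : numClosedFieldType).

Definition bounded_entries (n : nat) (F : I -> 'M[C]_n) : Prop :=
  exists c : C, forall s, P s -> forall i j, `|F s i j| <= c.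

Lemma bounded_entries_const (n : nat) (M : 'M[C]_n) :
  bounded_entries (fun _ => M).
Proof.
exists (\sum_i \sum_j `|M i j|) => s _ i j.
rewrite (bigD1 i) //= (bigD1 j) //= -addrA lerDl.
by rewrite addr_ge0 ?sumr_ge0 // => k _; rewrite sumr_ge0.
Qed.

Lemma bounded_entries_mul (n : nat) (F G : I -> 'M[C]_n) :
  bounded_entries F -> bounded_entries G ->
  bounded_entries (fun s => F s *m G s).
Proof.
move=> [a Fa] [b Gb]; exists (\sum_(k < n) a * b) => s Ps i j.
rewrite mxE; apply: le_trans (ler_norm_sum _ _ _) _; apply: ler_sum => k _.
by rewrite normrM ler_pM ?Fa ?Gb.
Qed.

Lemma bounded_entries_trC (n : nat) (F : I -> 'M[C]_n) :
  bounded_entries F -> bounded_entries (fun s => (F s)^t*).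
Proof.
by move=> [a Fa]; exists a => s Ps i j; rewrite !mxE norm_conjC Fa.
Qed.

Lemma bounded_entries_trace (n : nat) (F : I -> 'M[C]_n) :
  bounded_entries F -> exists c : C, forall s, P s -> `|\tr (F s)| <= c.
Proof.
move=> [a Fa]; exists (\sum_(k < n) a) => s Ps.
by apply: le_trans (ler_norm_sum _ _ _) _; apply: ler_sum => k _; exact: Fa.
Qed.
End BoundedEntries.

Section NormTerm.
Variables (R : realType) (n : nat) (N : 'M[R[i]]_n -> R).
Hypotheses (hN : is_mxnorm N) (hNU : unitarily_invariant N).
Variables (A B X : 'M[R[i]]_n) (r : R).
Hypotheses (hA : psdmx A) (hB : psdmx B) (r0 : 0 <= r).
Local Notation C := R[i].
Local Notation toC := (real_complex R).

(** [norm_CauchySchwarz] with E = A^d, F = B^d and Y = A^s X B^(1-t), where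
    d = (t - s) / 2. *)
Lemma norm_term_midpoint (s t : R) : 0 <= s -> s <= t -> t <= 1 ->
  norm_term N A B X r (2^-1 * (s + t)) (1 - 2^-1 * (s + t)) ^+ 2 <=
  norm_term N A B X r s (1 - s) * norm_term N A B X r t (1 - t).
Proof.
move=> s0 st t1; pose d := 2^-1 * (t - s).
have d0 : 0 <= d by rewrite mulr_ge0 ?invr_ge0 ?subr_ge0.
have t10 : 0 <= 1 - t by rewrite subr_ge0.
have := norm_CauchySchwarz hN hNU (mxpowR A s *m X *m mxpowR B (1 - t)) r0
  (mxpowR_trC d hA) (mxpowR_trC d hB).
have powA (u v w : R) : 0 <= u -> 0 <= v -> u + v = w ->
    mxpowR A u *m mxpowR A v = mxpowR A w.
  by move=> u0 v0 <-; rewrite (mxpowRD hA u0 v0).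
have powB (u v w : R) : 0 <= u -> 0 <= v -> u + v = w ->
    mxpowR B u *m mxpowR B v = mxpowR B w.
  by move=> u0 v0 <-; rewrite (mxpowRD hB u0 v0).
(* For arbitrary factors, only associativity is at stake; the power law then
   identifies the four products of two powers. *)
have transport (E S S1 S2 T F T1 T2 : 'M[C]_n) :
    E *m S = S1 -> E *m S1 = S2 -> T *m F = T1 -> T1 *m F = T2 ->
    N (mxpowR (mxabs (E *m (S *m X *m T) *m F)) r) ^+ 2 <=
      N (mxpowR (mxabs (E *m E *m (S *m X *m T))) r) *
      N (mxpowR (mxabs (S *m X *m T *m F *m F)) r) ->
    N (mxpowR (mxabs (S1 *m X *m T1)) r) ^+ 2 <=
      N (mxpowR (mxabs (S *m X *m T2)) r) * N (mxpowR (mxabs (S2 *m X *m T)) r).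
  move=> <- <- <- <-; rewrite [X in _ -> _ <= X]mulrC.
  by rewrite !mulmxA.
apply: transport.
- by apply: powA => //; rewrite /d; lra.
- by apply: powA => //; rewrite /d; lra.
- by apply: powB => //; rewrite /d; lra.
- by apply: powB => //; rewrite /d; lra.
Qed.

Lemma powR_le_1D (a s : R) : 0 <= a -> 0 <= s -> s <= 1 -> a `^ s <= 1 + a.
Proof.
move=> a0 s0 s1; have [a1|a1] := leP a 1.
  apply: (@le_trans _ _ (1 `^ s)); last by rewrite powR1 lerDl.
  by apply: ge0_ler_powR; rewrite ?nnegrE.
apply: (@le_trans _ _ (a `^ 1)); last by rewrite powRr1 // lerDr.
by apply: ler_powR => //; apply: ltW.
Qed.

Lemma bounded_mxpowR (M : 'M[C]_n) (e : R -> R) : psdmx M ->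
  bounded_entries (fun s => 0 <= e s <= 1) (fun s => mxpowR M (e s)).
Proof.
move=> /psdmx_rdiag[U [a [uU a0 ->]]].
have -> : (fun s => mxpowR (U^t* *m rdiag a *m U) (e s)) =
    (fun s => U^t* *m rdiag (fun i => a i `^ (e s)) *m U).
  by apply: funext => s; rewrite (mxpowR_rdiag _ _ uU); exact: erefl.
apply: bounded_entries_mul; last exact: bounded_entries_const.
apply: bounded_entries_mul; first exact: bounded_entries_const.
exists (toC (1 + \sum_i a i)) => s /andP[s0 s1] i j; rewrite !mxE.
have sum0 : 0 <= 1 + \sum_i a i by rewrite addr_ge0 // sumr_ge0.
case: (i == j); rewrite ?mulr1n ?mulr0n; last by rewrite normr0 ler0c.
rewrite ger0_norm ?ler0c ?powR_ge0 // lecR.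
apply: le_trans (powR_le_1D _ s0 s1) _ => //.
by rewrite lerD2l (bigD1 i) //= lerDl sumr_ge0.
Qed.

(** Each squared singular value is at most their sum, the trace of T'T. *)
Lemma norm_mxabs_pow_le_trace (T : 'M[C]_n) (c : R) :
  `|\tr (T^t* *m T)| <= toC c ->
  N (mxpowR (mxabs T) r) <= gauge N (fun _ => (c `^ 2^-1) `^ r).
Proof.
have [U [d [uU d0 ddec e]]] := singular_values T.
have trE : \tr (T^t* *m T) = toC (\sum_i d i).
  rewrite e mxtrace_mulC mulmxA (unitarymxP uU) mul1mx rmorph_sum /=.
  by apply: eq_bigr => i _; rewrite !mxE eqxx mulr1n.
have sd0 : 0 <= \sum_i d i by rewrite sumr_ge0.
rewrite {}trE ger0_norm ?ler0c // lecR => sd.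
rewrite (norm_mxabs_pow hNU r uU e); apply: (gauge_weak_majorization hN hNU).
- by move=> i; apply: powR_ge0.
- move=> i j ij; apply: ge0_ler_powR; rewrite ?nnegrE ?powR_ge0 //.
  by apply: ge0_ler_powR; rewrite ?nnegrE ?invr_ge0 //; exact: ddec.
move=> m _; apply: ler_sum => i _.
have dc : d i <= c by apply: le_trans sd; rewrite (bigD1 i) //= lerDl sumr_ge0.
have c0 := le_trans (d0 i) dc.
apply: ge0_ler_powR; rewrite ?nnegrE ?powR_ge0 //.
by apply: ge0_ler_powR; rewrite ?nnegrE ?invr_ge0.
Qed.

(** The powers have bounded entries for exponents in the unit interval, although
    they need not depend continuously on the exponent at 0. *)
Lemma norm_term_bounded : exists c : R, forall s, 0 <= s -> s <= 1 ->
  norm_term N A B X r s (1 - s) <= c.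
Proof.
pose P (s : R) := 0 <= s <= 1.
have bA : bounded_entries P (fun s => mxpowR A s).
  exact: (@bounded_mxpowR A id hA).
have bB : bounded_entries P (fun s => mxpowR B (1 - s)).
  have [c hc] := @bounded_mxpowR B (fun s => 1 - s) hB.
  by exists c => s /andP[s0 s1]; apply: hc; apply/andP; split; lra.
have bT := bounded_entries_mul (bounded_entries_mul bA (bounded_entries_const P X)) bB.
have [c hc] := bounded_entries_trace (bounded_entries_mul (bounded_entries_trC bT) bT).
exists (gauge N (fun _ => (complex.Re c `^ 2^-1) `^ r)) => s s0 s1.
apply: norm_mxabs_pow_le_trace.
have := hc s; rewrite /P s0 s1 => /(_ isT) le.
have cr : c \is Num.real := ger0_real (le_trans (normr_ge0 _) le).
by rewrite (RRe_real cr).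
Qed.

End NormTerm.

Section SymmetricProduct.
Variables (R : realType) (g : R -> R).
Hypothesis g0 : forall s, 0 <= g s.
Hypothesis g_midpoint : forall s t, 0 <= s -> s <= t -> t <= 1 ->
  g (2^-1 * (s + t)) ^+ 2 <= g s * g t.

(** Log-convexity passes to the product, and the geometric mean of the values
    at [s] and [t] is at most the arithmetic one. *)
Lemma sym_product_midpoint (s t : R) : let f s := g s * g (1 - s) in
  0 <= s <= 1 -> 0 <= t <= 1 -> f (2^-1 * (s + t)) <= 2^-1 * (f s + f t).
Proof.
move=> f; wlog st : s t / s <= t => [H s01 t01|].
  have [st|ts] := leP s t; first exact: H.
  by rewrite [s + t]addrC [f s + _]addrC; apply: H => //; apply: ltW.
move=> /andP[s0 s1] /andP[t0 t1].
have h1 := g_midpoint s0 st t1.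
have h2 : g (1 - 2^-1 * (s + t)) ^+ 2 <= g (1 - t) * g (1 - s).
  have -> : 1 - 2^-1 * (s + t) = 2^-1 * ((1 - t) + (1 - s)) by lra.
  by apply: g_midpoint; lra.
have f0 u : 0 <= f u by rewrite mulr_ge0.
have h : f (2^-1 * (s + t)) ^+ 2 <= f s * f t.
  rewrite exprMn; apply: le_trans (ler_pM _ _ h1 h2) _; rewrite ?exprn_ge0 //.
  by rewrite [g (1 - t) * _]mulrC mulrACA.
rewrite -(ler_pXn2r (ltn0Sn 1)) ?nnegrE ?f0 //; last first.
  by rewrite mulr_ge0 ?invr_ge0 ?addr_ge0.
apply: le_trans h _; rewrite -subr_ge0.
have -> : (2^-1 * (f s + f t)) ^+ 2 - f s * f t = (2^-1 * (f s - f t)) ^+ 2.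
  by move: (f s) (f t) => a b; field.
exact: sqr_ge0.
Qed.
End SymmetricProduct.

(** * Symmetric midpoint convex functions on the unit interval *)

Local Open Scope classical_set_scope.
Local Open Scope ring_scope.

Section Trapezoid.
Variable R : realType.
Local Notation mu := (@lebesgue_measure R).

(** Bernstein-Doetsch. The difference [h] of [f] and its chord is midpoint
    convex, vanishes at [a] and [b], and is bounded above by some [M]. A point
    of the interval is the midpoint of the nearer end and another point of the
    interval, so h <= M implies h <= M / 2, and so on. *)
Lemma midpoint_convex_chord (f : R -> R) (a b c : R) : a < b ->
  (forall s t, a <= s <= b -> a <= t <= b ->
     f (2^-1 * (s + t)) <= 2^-1 * (f s + f t)) ->
  (forall s, a <= s <= b -> f s <= c) ->
  forall s, a <= s <= b -> f s <= f a + (s - a) / (b - a) * (f b - f a).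
Proof.
move=> ab fmid fc.
pose l s := f a + (s - a) / (b - a) * (f b - f a).
have la : l a = f a by rewrite /l subrr !mul0r addr0.
have lb : l b = f b by rewrite /l divff ?gt_eqF ?subr_gt0 // mul1r addrC subrK.
have lmid s t : l (2^-1 * (s + t)) = 2^-1 * (l s + l t).
  by rewrite /l; field; rewrite gt_eqF ?subr_gt0.
pose M := `|c| + `|f a| + `|f b|.
have M0 : 0 <= M by rewrite !addr_ge0.
have hM s : a <= s <= b -> f s - l s <= M.
  move=> sab; have := fc _ sab; have := ler_norm c.
  have lge : - (`|f a| + `|f b|) <= l s.
    pose t := (s - a) / (b - a); case/andP: sab => as_ sb.
    have t0 : 0 <= t by rewrite divr_ge0 // subr_ge0 // ltW.
    have t1 : t <= 1 by rewrite ler_pdivrMr ?subr_gt0 // mul1r lerD2r.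
    have -> : l s = (1 - t) * f a + t * f b by rewrite /l -/t; ring.
    have fa : - `|f a| <= f a by rewrite lerNl -normrN ler_norm.
    have fb : - `|f b| <= f b by rewrite lerNl -normrN ler_norm.
    have := ler_wpM2l t0 fb; have t1' : 0 <= 1 - t by lra.
    have := ler_wpM2l t1' fa.
    have := mulr_ge0 t0 (normr_ge0 (f a)); have := mulr_ge0 t1' (normr_ge0 (f b)).
    lra.
  by rewrite /M; lra.
have hk k s : a <= s <= b -> (f s - l s) * 2 ^+ k <= M.
  elim: k s => [|k IH] s sab; first by rewrite expr0 mulr1 hM.
  (* s is the midpoint of the nearer end e of the interval and a point y of it. *)
  have half y e : a <= y <= b -> a <= e <= b -> f e = l e -> s = 2^-1 * (e + y) ->
      (f s - l s) * 2 ^+ k.+1 <= M.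
    move=> yab eab fe sE; apply: le_trans (IH y yab).
    rewrite exprS mulrA ler_wpM2r ?exprn_ge0 //.
    have := fmid _ _ eab yab; rewrite -sE fe.
    have := lmid e y; rewrite -sE => ->.
    by lra.
  case/andP: sab => as_ sb.
  have [le|lt] := leP s (2^-1 * (a + b)).
    by apply: (half (2 * s - a) a); rewrite ?la //; lra.
  by apply: (half (2 * s - b) b); rewrite ?lb //; lra.
move=> s sab; rewrite -/(l s) -subr_le0 leNgt; apply/negP => h0.
have := archi_boundP (divr_ge0 M0 (ltW h0)); set k := Num.bound _.
rewrite ltr_pdivrMr // => Mk.
have : k%:R * (f s - l s) <= M.
  apply: le_trans (hk k s sab); rewrite mulrC ler_pM2l //.
  by rewrite -natrX ler_nat ltnW // ltn_expl.
by rewrite leNgt Mk.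
Qed.

(** Composing with the projection onto the interval gives a function that is
    monotone on the whole line. *)
Lemma monotone_itv_measurable (f : R -> R) (a b : R) : a <= b ->
  (forall x y, a <= x -> x <= y -> y <= b -> f x <= f y) ->
  measurable_fun `[a, b] f.
Proof.
move=> ab fmono; pose p x := Num.min b (Num.max a x).
have pab x : a <= p x <= b by rewrite /p ge_min lexx le_min ab le_max lexx.
have pE x : a <= x <= b -> p x = x.
  by case/andP=> ax xb; rewrite /p (max_idPr ax) (min_idPr xb).
apply: (@eq_measurable_fun _ _ _ _ _ (f \o p)) => [x|].
  by rewrite inE /= in_itv /= => /pE ->.
apply: nondecreasing_measurable => // x y xy /=.
have /andP[ap _] := pab x; have /andP[_ pb] := pab y.
apply: fmono => //; rewrite /p.
by rewrite le_min ge_min lexx /= ge_min; apply/orP; right;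
  rewrite ge_max !le_max lexx xy orbT.
Qed.

Lemma bounded_itv_integrable (f : R -> R) (a b c : R) :
  measurable_fun `[a, b] f ->
  (forall s, a <= s <= b -> `|f s| <= c) ->
  mu.-integrable `[a, b] (EFin \o f).
Proof.
move=> mf fc; apply: measurable_bounded_integrable => //.
  by rewrite /= lebesgue_measure_itv /=; case: ifP => // _; rewrite -EFinB ltry.
exists c; split; first exact: num_real.
move=> x cx s /=; rewrite in_itv /= => /fc h; exact: le_trans h (ltW cx).
Qed.

Lemma Rintegral_affine (a b p q : R) : a < b ->
  \int[mu]_(s in `[a, b]) (p + q * s) = (b - a) * (p + q * (2^-1 * (a + b))).
Proof.
move=> ab; rewrite /Rintegral.
pose F s : R := p * s + q * (2^-1 * s ^+ 2).
have dF (x : R) : is_derive x 1 F (p + q * x).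
  by apply: is_derive_eq; rewrite /GRing.scale /=; field.
have cF : continuous F.
  by move=> x; apply: differentiable_continuous; apply/derivable1_diffP; case: (dF x).
rewrite (@continuous_FTC2 _ _ F) //.
- by rewrite -EFinB /= /F; field.
- apply: continuous_subspaceT => x.
  apply: cvgD; first exact: cvg_cst.
  by apply: cvgM; [exact: cvg_cst|exact: cvg_id].
- split.
  + by move=> x _; case: (dF x).
  + by apply: cvg_at_right_filter; exact: cF.
  + by apply: cvg_at_left_filter; exact: cF.
- by move=> x _; rewrite derive1E; case: (dF x).
Qed.

Lemma Rintegral_le_trapezoid (f : R -> R) (a b : R) : a < b ->
  mu.-integrable `[a, b] (EFin \o f) ->
  (forall s, a <= s <= b -> f s <= f a + (s - a) / (b - a) * (f b - f a)) ->
  \int[mu]_(s in `[a, b]) f s <= (b - a) * (2^-1 * (f a + f b)).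
Proof.
move=> ab intf fle; pose q := (f b - f a) / (b - a).
have ba0 : b - a != 0 by rewrite gt_eqF // subr_gt0.
apply: (@le_trans _ _ (\int[mu]_(s in `[a, b]) ((f a - q * a) + q * s))).
  apply: le_Rintegral => // [|s].
    apply: (@bounded_itv_integrable _ _ _ (`|f a - q * a| + `|q| * (`|a| + `|b|))).
      apply: measurable_funD => //; apply: measurable_funM => //.
    move=> s /andP[as_ sb]; apply: le_trans (ler_normD _ _) _; rewrite lerD2l normrM.
    rewrite ler_wpM2l // ler_norml.
    have := ler_norm b; have := ler_norm (- a); rewrite normrN.
    have := normr_ge0 a; have := normr_ge0 b.
    by move=> *; apply/andP; split; lra.
  rewrite /= in_itv /= => /fle; congr (_ <= _); rewrite /q; field.
  exact: ba0.
rewrite Rintegral_affine // /q le_eqVlt; apply/orP; left; apply/eqP; field.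
exact: ba0.
Qed.

End Trapezoid.

Section HermiteHadamard.
Variables (R : realType) (f : R -> R) (c : R).
Local Notation mu := (@lebesgue_measure R).
Local Notation h := (2^-1 : R).
Hypothesis f_midpoint : forall s t, 0 <= s <= 1 -> 0 <= t <= 1 ->
  f (h * (s + t)) <= h * (f s + f t).
Hypothesis f_sym : forall s, f (1 - s) = f s.
Hypothesis f_ge0 : forall s, 0 <= f s.
Hypothesis f_le : forall s, 0 <= s <= 1 -> f s <= c.

(** 1/2 is the midpoint of [s] and [1 - s]. *)
Lemma sym_convex_min (s : R) : 0 <= s <= 1 -> f h <= f s.
Proof.
move=> s01; have s01' : 0 <= 1 - s <= 1 by lra.
have := f_midpoint s01 s01'; rewrite f_sym.
have -> : h * (s + (1 - s)) = h by lra.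
by lra.
Qed.

Lemma sym_convex_chord (a b : R) : 0 <= a -> a < b -> b <= 1 ->
  forall s, a <= s <= b -> f s <= f a + (s - a) / (b - a) * (f b - f a).
Proof.
move=> a0 ab b1; apply: (@midpoint_convex_chord _ _ _ _ c ab) => [s t sab tab|s sab].
  by apply: f_midpoint; lra.
by apply: f_le; lra.
Qed.

(** [f] lies below its chord from 1/2 to [y], which is nondecreasing as [f] is
    minimal at 1/2. *)
Lemma sym_convex_mono (x y : R) : h <= x -> x <= y -> y <= 1 -> f x <= f y.
Proof.
move=> hx xy y1; have [yh|hy] := leP y h.
  by have -> : x = y by lra.
have hxy : h <= x <= y by rewrite hx xy.
have h0 : 0 <= h by lra.
have := sym_convex_chord h0 hy y1 hxy.
have fhy : f h <= f y by apply: sym_convex_min; lra.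
have t0 : 0 <= y - x by lra.
have yh0 : 0 < y - h by lra.
move/le_trans; apply; rewrite -subr_ge0.
have -> : f y - (f h + (x - h) / (y - h) * (f y - f h)) =
    (y - x) / (y - h) * (f y - f h) by field; rewrite gt_eqF //; lra.
by rewrite mulr_ge0 ?divr_ge0 ?subr_ge0 // ltW.
Qed.

Lemma sym_convex_integrable (b : R) : h <= b -> b <= 1 ->
  [/\ mu.-integrable `[h, b] (EFin \o f),
      mu.-integrable `[1 - b, h] (EFin \o f)
    & mu.-integrable `[1 - b, b] (EFin \o f)].
Proof.
move=> hb b1.
have mright : measurable_fun `[h, b] f.
  apply: monotone_itv_measurable => // x y hx xy yb.
  by apply: sym_convex_mono => //; lra.
have mleft : measurable_fun `[1 - b, h] f.
  suff: measurable_fun `[1 - b, h] (\- f)%R.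
    by move/measurable_funN; apply: eq_measurable_fun => x _ /=; rewrite opprK.
  apply: monotone_itv_measurable => [|x y bx xy yh]; first by lra.
  rewrite /= lerN2 -(f_sym x) -(f_sym y).
  by apply: sym_convex_mono; lra.
have bnd s : 0 <= s <= 1 -> `|f s| <= c by move=> s01; rewrite ger0_norm ?f_le.
split; apply: (@bounded_itv_integrable _ _ _ _ c) => //;
  try by move=> s sI; apply: bnd; lra.
have -> : [set` `[1 - b, b]] = [set` `[1 - b, h]] `|` [set` `[h, b]].
  apply/seteqP; split=> x /=; rewrite !in_itv /=.
    by move=> /andP[x1 x2]; have [xh|xh] := leP x h; [left|right]; lra.
  by case=> /andP[x1 x2]; lra.
by apply/measurable_funU.
Qed.

(** The lower bound holds as [f] is minimal at 1/2; the upper one is the trapezoid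
    rule on each half of the interval. *)
Lemma Hermite_Hadamard (b : R) : h < b -> b <= 1 ->
  (2 * b - 1) * f h <= \int[mu]_(s in `[1 - b, b]) f s /\
  \int[mu]_(s in `[1 - b, b]) f s <= (2 * b - 1) * (h * (f h + f b)).
Proof.
move=> hb b1; have [intr intl int] := sym_convex_integrable (ltW hb) b1.
have b10 : 1 - b < h by lra.
split.
  have -> : (2 * b - 1) * f h = \int[mu]_(s in `[1 - b, b]) f h.
    rewrite Rintegral_cst //= lebesgue_measure_itv /= lte_fin.
    have -> : 1 - b < b by lra.
    by rewrite -EFinB /= mulrC; congr (_ * _); lra.
  apply: le_Rintegral => // [|s].
    apply: (@bounded_itv_integrable _ _ _ _ `|f h|) => //.
  by rewrite /= in_itv /= => sI; apply: sym_convex_min; lra.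
have := @Rintegral_itvB R f (BLeft (1 - b)) (BRight b) h int.
rewrite !bnd_simp => /(_ (ltW b10) (ltW hb)).
rewrite Rintegral_itv_obnd_cbnd; last first.
  apply: integrableS intr => //; apply: subset_itvr; by rewrite bnd_simp.
move=> /(canRL (subrK _)) ->.
have h0 : 0 <= h by lra.
have b0 : 0 <= 1 - b by lra.
have h1 : h <= 1 by lra.
have le1 := Rintegral_le_trapezoid hb intr (sym_convex_chord h0 hb b1).
have le2 := Rintegral_le_trapezoid b10 intl (sym_convex_chord b0 b10 h1).
apply: le_trans (lerD le1 le2) _.
by rewrite f_sym; lra.
Qed.

Definition sym_mean (m : R) : R :=
  `|1 - 2 * m|^-1 * `|oriented_integral m (1 - m) f|.

Lemma sym_mean_bounds (m : R) : 0 <= m -> m <= 1 -> m != h ->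
  f h <= sym_mean m /\ sym_mean m <= h * (f h + f m).
Proof.
move=> m0 m1 mh.
have key b : h < b -> b <= 1 -> f h <= (2 * b - 1)^-1 * `|\int[mu]_(s in `[1 - b, b]) f s| /\
    (2 * b - 1)^-1 * `|\int[mu]_(s in `[1 - b, b]) f s| <= h * (f h + f b).
  move=> hb b1; have [lo up] := Hermite_Hadamard hb b1.
  have p0 : 0 < 2 * b - 1 by lra.
  rewrite ger0_norm; last by apply: le_trans lo; rewrite mulr_ge0 // ltW.
  by rewrite ler_pdivlMl // ler_pdivrMl.
rewrite /sym_mean /oriented_integral; have [mle|mlt] := leP m (1 - m).
  have {mle}mh' : h < 1 - m by move: mh; rewrite neq_lt => /orP[]; lra.
  have := key (1 - m) mh'; rewrite f_sym opprB addrCA subrr addr0.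
  rewrite (@ger0_norm _ (1 - 2 * m)); last by lra.
  have -> : 2 * (1 - m) - 1 = 1 - 2 * m by lra.
  by apply; lra.
have hm : h < m by lra.
rewrite normrN (@ltr0_norm _ (1 - 2 * m)); last by lra.
have -> : - (1 - 2 * m) = 2 * m - 1 by lra.
exact: key.
Qed.

Lemma sym_convex_near_min (m : R) : 0 <= m -> m <= 1 ->
  f m <= f h + `|2 * m - 1| * (f 1 - f h).
Proof.
wlog hm : m / h <= m => [H m0 m1|m0 m1].
  have [hm|mh] := leP h m; first exact: H.
  have := H (1 - m); rewrite f_sym.
  have -> : 2 * (1 - m) - 1 = - (2 * m - 1) by lra.
  by rewrite normrN; apply; lra.
have h0 : 0 <= h by lra.
have h1 : h < 1 by lra.
have hm1 : h <= m <= 1 by lra.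
have := sym_convex_chord h0 h1 (lexx 1) hm1.
rewrite ger0_norm; last by lra.
have -> : (m - h) / (1 - h) = 2 * m - 1 by field.
by [].
Qed.

(** The mean is squeezed between its bounds, since [f] lies below its chords
    from 1/2 to 0 and to 1, hence is continuous at its minimum. *)
Lemma sym_mean_cvg : sym_mean x @[x --> h^'] --> f h.
Proof.
apply: (@squeeze_cvgr _ _ _ _ (fun=> f h)
  (fun x => f h + h * (`|2 * x - 1| * (f 1 - f h)))).
- near=> x.
  have xh : x != h by near: x; exact: nbhs_dnbhs_neq.
  have x01 : 0 <= x /\ x <= 1.
    have : `|h - x| < h.
      near: x; apply: nbhs_dnbhs; apply: nbhsx_ballx; lra.
    by rewrite ltr_norml => /andP[]; split; lra.
  have [x0 x1] := x01; have [lo up] := sym_mean_bounds x0 x1 xh.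
  rewrite lo /=; apply: le_trans up _.
  by have := sym_convex_near_min x0 x1; lra.
- exact: cvg_cst.
- have ct : continuous (fun x : R => f h + h * (`|2 * x - 1| * (f 1 - f h))).
    move=> x; apply: cvgD; first exact: cvg_cst.
    apply: cvgM; first exact: cvg_cst.
    apply: cvgM; last exact: cvg_cst.
    apply: cvg_norm; apply: cvgB; last exact: cvg_cst.
    by apply: cvgM; [exact: cvg_cst|exact: cvg_id].
  have := ct h; rewrite /continuous_at divff // subrr normr0 mul0r mulr0 addr0.
  exact: cvg_trans (cvg_app _ (@nbhs_dnbhs _ h)).
Unshelve. all: by end_near.
Qed.
End HermiteHadamard.

(** * The theorem *)

(** Here [k s t] stands for the norm of |A^s X B^t|^r. *)
Lemma Hermite_Hadamard_symmetrized (R : realType) (k : R -> R -> R) (c m : R) :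
  (forall s t, 0 <= k s t) ->
  (forall s t, 0 <= s -> s <= t -> t <= 1 ->
     k (2^-1 * (s + t)) (1 - 2^-1 * (s + t)) ^+ 2 <= k s (1 - s) * k t (1 - t)) ->
  (forall s, 0 <= s -> s <= 1 -> k s (1 - s) <= c) ->
  0 <= m -> m <= 1 ->
  let M x := sym_mean (fun s => k s (1 - s) * k (1 - s) s) x in
  let M' := if m == 2^-1 then lim (M x @[x --> (2^-1 : R)^']) else M m in
  [/\ k 2^-1 2^-1 ^+ 2 <= M',
      M' <= 2^-1 * (k 2^-1 2^-1 ^+ 2 + k m (1 - m) * k (1 - m) m),
      2^-1 * (k 2^-1 2^-1 ^+ 2 + k m (1 - m) * k (1 - m) m) <=
        k m (1 - m) * k (1 - m) m
    & M x @[x --> (2^-1 : R)^'] --> k 2^-1 2^-1 ^+ 2].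
Proof.
move=> k0 kmid kc m0 m1 M M'.
have half : 1 - 2^-1 = 2^-1 :> R by lra.
pose g s := k s (1 - s); pose f s := k s (1 - s) * k (1 - s) s.
have subK (s : R) : 1 - (1 - s) = s by lra.
have fE : f = fun s => g s * g (1 - s).
  by apply: funext => s; rewrite /f /g subK.
have fhalf : f 2^-1 = k 2^-1 2^-1 ^+ 2 by rewrite /f half expr2.
have f_sym s : f (1 - s) = f s by rewrite /f subK mulrC.
have f_ge0 s : 0 <= f s by rewrite mulr_ge0.
have f_le s : 0 <= s <= 1 -> f s <= c * c.
  move=> /andP[s0 s1]; rewrite /f -{4}[s]subK.
  by rewrite ler_pM // kc //; lra.
have f_mid s t : 0 <= s <= 1 -> 0 <= t <= 1 ->
    f (2^-1 * (s + t)) <= 2^-1 * (f s + f t).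
  rewrite fE; apply: sym_product_midpoint => [u|]; first exact: k0.
  exact: kmid.
have cvgM : M x @[x --> (2^-1 : R)^'] --> k 2^-1 2^-1 ^+ 2.
  by rewrite -fhalf; exact: (sym_mean_cvg f_mid f_sym f_ge0 f_le).
have min_m : f 2^-1 <= f m by apply: (sym_convex_min f_mid f_sym); rewrite m0 m1.
rewrite -[k m (1 - m) * _]/(f m) -fhalf in cvgM *.
rewrite /M'; case: (eqVneq m 2^-1) => [mh|mh].
  have -> := cvg_lim (@Rhausdorff R) cvgM.
  by split=> //; rewrite ?mh; lra.
have [lo up] := sym_mean_bounds f_mid f_sym f_ge0 f_le m0 m1 mh.
by split=> //; lra.
Qed.

Theorem proposition2p2 (R : realType) (n : nat) (A B X : 'M[R[i]]_n) (r : R)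
    (hA : psdmx A) (hB : psdmx B) (hr : 0 <= r)
    (mu : R) (hmu0 : 0 <= mu) (hmu1 : mu <= 1)
    (N : 'M[R[i]]_n -> R) (hN : is_mxnorm N) (hNU : unitarily_invariant N) :
  [/\ norm_term N A B X r 2^-1 2^-1 ^+ 2 <= mean_term_ext N A B X r mu,
      mean_term_ext N A B X r mu <=
        2^-1 * (norm_term N A B X r 2^-1 2^-1 ^+ 2
                + norm_term N A B X r mu (1 - mu)
                  * norm_term N A B X r (1 - mu) mu),
      2^-1 * (norm_term N A B X r 2^-1 2^-1 ^+ 2
              + norm_term N A B X r mu (1 - mu)
                * norm_term N A B X r (1 - mu) mu) <=
        norm_term N A B X r mu (1 - mu) * norm_term N A B X r (1 - mu) mu
    & mean_term N A B X r x @[x --> (2^-1 : R)^'] -->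
        norm_term N A B X r 2^-1 2^-1 ^+ 2].
Proof.
have [c hc] := norm_term_bounded hN hNU X hA hB hr.
have k0 s t : 0 <= norm_term N A B X r s t by exact: (mxnorm_ge0 hN).
have kmid := norm_term_midpoint hN hNU X hA hB hr.
rewrite /mean_term_ext /mean_term.
move: (norm_term N A B X r) k0 kmid hc => k k0 kmid kc.
exact: (Hermite_Hadamard_symmetrized k0 kmid kc hmu0 hmu1).
Qed.
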